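(* Let $r$ be a positive integer and let $\epsilon>0$. Then there exists a constant $\kappa=\kappa(r,\epsilon)>0$, depending only on $r$ and $\epsilon$, such that the following holds. For every integer $n\ge 2$ there exist an integer $k\le\kappa\ln n$ and linear forms $\ell_{ij}:\mathbb{R}^n\to\mathbb{R}$, $i=1,\ldots,k$, $j=1,\ldots,r$, such that the polynomial $\tilde e_r(\mathbf{x})=\sum_{i=1}^k\prod_{j=1}^r\ell_{ij}(\mathbf{x})$ is a linear combination of square-free monomials of degree $r$, $$\tilde e_r(\mathbf{x})=\sum_{\substack{I=\{i_1,\ldots,i_r\}\\ 1\le i_1<i_2<\cdots<i_r\le n}}\tilde e_{r,I}\,x_{i_1}\cdots x_{i_r},$$ and $$(1-\epsilon)^r\le\tilde e_{r,I}\le(1+\epsilon)^r$$ for all $r$-element subsets $I\subset\{1,\ldots,n\}$.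
   Context: $\mathbf{x}=(x_1,\ldots,x_n)$. A linear form is a homogeneous linear function $\mathbb{R}^n\to\mathbb{R}$. *)

(* Defs.v *)
From mathcomp Require Import all_boot all_order all_algebra.
From mathcomp Require Import reals exp.
Import Order.TTheory GRing.Theory Num.Theory.
Set Implicit Arguments.
Unset Strict Implicit.
Unset Printing Implicit Defensive.
Local Open Scope ring_scope.

Section Definitions.
Context {R : realType} {n : nat}.

Definition sum_of_products (k r : nat)
    (l : 'I_k -> 'I_r -> {scalar 'rV[R]_n}) (x : 'rV[R]_n) : R :=
  \sum_(i < k) \prod_(j < r) l i j x.

Definition squarefree_poly (r : nat) (c : {set 'I_n} -> R) (x : 'rV[R]_n) : R :=
  \sum_(I : {set 'I_n} | #|I| == r) c I * \prod_(i in I) x ord0 i.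

End Definitions.

(* Main.v *)
Require Import Defs.
From HB Require Import structures.
From mathcomp Require Import all_boot all_order all_algebra.
From mathcomp Require Import reals exp.
From mathcomp Require Import ring lra zify.
Import Order.TTheory GRing.Theory Num.Theory.
Set Implicit Arguments.
Unset Strict Implicit.
Unset Printing Implicit Defensive.
Local Open Scope ring_scope.

(* Colour the variables randomly with r colours. The product over the colours of
   the sums of the variables of each colour is the sum of the monomials x_I over
   the rainbow r-sets I, and I is rainbow with probability p = r!/r^r. By the
   Chernoff bound and a union bound over at most n^r sets, O(ln n) colourings
   suffice for every I to be rainbow in nearly the expected number of them; the
   sum of these products, suitably scaled, is the required polynomial. *)

(** * Concentration for a well-chosen sample *)

(* Method of conditional expectations: the samples are chosen one at a time, so
   that no product probability space is needed. *)
Lemma exists_prod_weight_le (R : realFieldType) (W T : finType) (P : pred T)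
    (A : W -> T -> R) (k : nat) :
  (0 < #|W|)%N -> (forall w t, P t -> 0 <= A w t) ->
  (forall t, P t -> \sum_w A w t = #|W|%:R) ->
  exists s : 'I_k -> W, \sum_(t | P t) \prod_(i < k) A (s i) t <= #|P|%:R.
Proof.
move=> W0 A0 AW; elim: k => [|k [s IHs]].
  have [w _] := card_gt0P W0; exists (fun=> w).
  under eq_bigr do rewrite big_ord0.
  by rewrite sumr_const.
pose B t := \prod_(i < k) A (s i) t.
(* Averaging over [w]: each [A w t] has mean 1, so some [w] does not increase the total. *)
have [w Hw] : exists w, \sum_(t | P t) A w t * B t <= \sum_(t | P t) B t.
  apply/existsP; apply: contraT; rewrite negb_exists => /forallP Hw.
  have [w0 _] := card_gt0P W0.
  suff: \sum_(w : W) \sum_(t | P t) B t < \sum_w \sum_(t | P t) A w t * B t.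
    rewrite [ltRHS]exchange_big /= [ltRHS](_ : _ = \sum_(t | P t) \sum_(w : W) B t).
      by rewrite [ltRHS]exchange_big /= ltxx.
    apply: eq_bigr => t Pt.
    by rewrite -mulr_suml AW// sumr_const mulr_natl.
  apply: ltr_sum => [|w _]; last by rewrite ltNge Hw.
  by apply/hasP; exists w0 => //; rewrite mem_index_enum.
exists (fun i => if unlift ord0 i is Some j then s j else w).
apply: le_trans IHs; apply: le_trans Hw.
apply: ler_sum => t Pt; rewrite big_ord_recl unlift_none.
by under eq_bigr do rewrite liftK.
Qed.

(** This is ln (1 + x) <= x taken at x = (1 + a)^-1 - 1 = - a / (1 + a). *)
Lemma ge_ln1Dx (R : realType) (a : R) : -1 < a -> a / (1 + a) <= ln (1 + a).
Proof.
move=> a1; have a0 : 0 < 1 + a by lra.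
have ai : 0 < (1 + a)^-1 by rewrite invr_gt0.
have E : 1 + - (a / (1 + a)) = (1 + a)^-1 by field; rewrite gt_eqF.
rewrite -lerN2 -lnV ?posrE//; have := @le_ln1Dx R (- (a / (1 + a))).
by rewrite E; apply; rewrite -subr_gt0 opprK addrC E.
Qed.

(* The Chernoff bound, with a union bound over P: the weights are the normalized
   exponential moments (1 +- d)^X / (1 +- d p) of both tails. *)
Lemma exists_concentrated_sample (R : realType) (W T : finType) (P : pred T)
    (X : W -> T -> bool) (p d : R) (k : nat) :
  (0 < #|W|)%N -> 0 < p <= 1 -> 0 < d < 1 ->
  (forall t, P t -> #|[set w | X w t]|%:R = p * #|W|%:R) ->
  ln (2 * #|P|)%:R <= d ^+ 2 * (k%:R * p) ->
  exists s : 'I_k -> W, forall t, P t ->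
    (1 - d) ^+ 2 * (k%:R * p) <= (\sum_(i < k) X (s i) t)%:R
      <= (1 + d) ^+ 2 * (k%:R * p).
Proof.
move=> W0 /andP[p0 p1] /andP[d0 d1] XW Hk.
(* [b] selects the tail, upper for [true] and lower for [false]; indexing by pairs (t, b) turns
   [#|P|] into [2 * #|P|]. *)
pose a (b : bool) : R := if b then d else - d.
have a1 b : -1 < a b by rewrite /a; case: b; lra.
have ap b : 0 < 1 + a b * p by rewrite /a; case: b; nra.
pose Q (u : T * bool) := P u.1.
pose A w (u : T * bool) := (1 + a u.2 * (X w u.1)%:R) / (1 + a u.2 * p).
have A0 w u : 0 < A w u.
  rewrite divr_gt0//; by have := a1 u.2; case: (X w u.1); rewrite ?mulr1 ?mulr0; lra.
have AW u : Q u -> \sum_w A w u = #|W|%:R.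
  move=> Pu; rewrite -mulr_suml big_split /= sumr_const -mulr_sumr.
  rewrite -natr_sum -[X in X%:R](_ : #|[set w | X w u.1]| = _)%N; last first.
    rewrite -sum1_card big_mkcond /=; apply: eq_bigr => w _.
    by rewrite inE; case: (X w u.1).
  by rewrite XW// mulrA -[X in X + _]mul1r -mulrDl mulrAC divff ?mul1r// gt_eqF.
have [s Hs] := exists_prod_weight_le k W0 (fun w u _ => ltW (A0 w u)) AW.
have cardQ : #|Q| = (2 * #|P|)%N.
  rewrite mulnC -card_bool -cardX; apply: eq_card => u.
  by rewrite !unfold_in /= andbT.
(* One term of a nonnegative sum is at most the whole sum; take logarithms of this. *)
have key t b : P t -> (\sum_(i < k) X (s i) t)%:R * (a b / (1 + a b)) <=
    d ^+ 2 * (k%:R * p) + k%:R * (a b * p).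
  move=> Pt; set S := (\sum_(i < k) _)%N.
  have ab : 0 < 1 + a b by have := a1 b; lra.
  have H : (1 + a b) ^+ S / (1 + a b * p) ^+ k <= (2 * #|P|)%:R.
    rewrite -cardQ; apply: le_trans Hs.
    rewrite (bigD1 (t, b)) //= (_ : \prod_(i < k) _ = (1 + a b) ^+ S / (1 + a b * p) ^+ k).
      rewrite lerDl sumr_ge0// => u _; rewrite prodr_ge0// => i _; exact: ltW.
    rewrite /A /= big_split /= prodfV prodr_const card_ord; congr (_ / _).
    rewrite /S -prodrXr; apply: eq_bigr => i _.
    by case: (X (s i) t); rewrite ?mulr1 ?expr1 ?mulr0 ?addr0 ?expr0.
  have L0 : 0 < (1 + a b) ^+ S / (1 + a b * p) ^+ k by rewrite divr_gt0 ?exprn_gt0.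
  have := H; rewrite -ler_ln ?posrE ?(lt_le_trans L0)// => /le_trans/(_ Hk).
  rewrite ln_div ?posrE ?exprn_gt0// !lnXn// -!(mulr_natl (ln _)) => H'.
  have l1 : ln (1 + a b * p) <= a b * p by apply: le_ln1Dx; have := ap b; lra.
  have l2 := ge_ln1Dx (a1 b).
  have := ler_wpM2l (ler0n R S) l2; have := ler_wpM2l (ler0n R k) l1; lra.
exists s => t Pt; set S := (\sum_(i < k) _)%:R.
have := key t true Pt; have := key t false Pt; rewrite -/S /a.
rewrite ![k%:R * (_ * p)]mulrCA; set K := k%:R * p.
rewrite [S * (- d / _)]mulrA ler_pdivrMr; last lra.
rewrite [S * (d / _)]mulrA ler_pdivrMr; last lra.
(* With a = d or a = - d, the bound d^2 K + a K equals a (1 + a) K. Multiplying by 1 + a and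
   cancelling d yields the squares. *)
move=> lo hi; apply/andP; split; rewrite -(ler_pM2l d0); lra.
Qed.

(** * Rainbow sets: expansion and counting *)

(* The sections g of f with image I are unique (card_section_on), so that
   rainbow f I says that f restricts to a bijection from I onto the colours. *)
Definition section_on (r n : nat) (f : {ffun 'I_n -> 'I_r}) (I : {set 'I_n})
    (g : {ffun 'I_r -> 'I_n}) : bool :=
  [forall j, f (g j) == j] && (g @: setT == I).

Definition rainbow (r n : nat) (f : {ffun 'I_n -> 'I_r}) (I : {set 'I_n}) : bool :=
  [exists g, section_on f I g].

Lemma card_section_on (r n : nat) (f : {ffun 'I_n -> 'I_r}) (I : {set 'I_n}) :
  #|[set g | section_on f I g]| = rainbow f I.
Proof.
rewrite /rainbow; case: existsP => [[g0 Hg0]|noS]; last first.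
  by apply: eq_card0 => g; rewrite inE; apply/negP => Hg; apply: noS; exists g.
rewrite -[RHS](cards1 g0); apply: eq_card => g; rewrite !inE.
apply/idP/eqP => [Hg|->//]; apply/ffunP => j.
case/andP: Hg0 => /forallP f0 /eqP I0; case/andP: Hg => /forallP fg /eqP Ig.
have: g j \in g0 @: setT by rewrite I0 -Ig imset_f.
by case/imsetP => j' _ E; have := eqP (fg j); rewrite E (eqP (f0 j')) => ->.
Qed.

(** Expanding the product picks one variable of each colour, that is, a section of [f]. Sections are
    injective; group them by their image, each image arising at most once. *)
Lemma prod_color_sums (R : realType) (r n : nat) (f : {ffun 'I_n -> 'I_r})
    (x : 'I_n -> R) :
  \prod_(j < r) \sum_(i | f i == j) x i =
  \sum_(I : {set 'I_n} | #|I| == r) (rainbow f I)%:R * \prod_(i in I) x i.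
Proof.
have ginj g : [forall j, f (g j) == j] -> {in setT &, injective g}.
  move=> /forallP fg j j' _ _ E.
  by rewrite -(eqP (fg j)) -[RHS](eqP (fg j')) E.
rewrite (bigA_distr_big_dep (fun j i => f i == j) (fun _ i => x i)).
rewrite (partition_big (fun g : {ffun 'I_r -> 'I_n} => g @: setT)
  (fun I : {set 'I_n} => #|I| == r)) /=; last first.
  move=> g /familyP fg; rewrite card_in_imset ?cardsT ?card_ord//.
  by apply: ginj; apply/forallP => j; have := fg j.
apply: eq_bigr => I _.
rewrite -card_section_on -sum1_card natr_sum mulr_suml.
apply: eq_big => [g|g /andP[/familyP fg /eqP <-]].
  by rewrite inE; congr (_ && _); apply/familyP/forallP => H j; exact: H.
rewrite mul1r big_imset /=; last by apply: ginj; apply/forallP => j; have := fg j.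
by apply: eq_bigl => j; rewrite inE.
Qed.

(** The colour is forced at the r points of the image of [g] and free elsewhere; [F i] is the set of
    colours allowed at [i]. *)
Lemma card_extensions (r n : nat) (g : {ffun 'I_r -> 'I_n}) : injective g ->
  #|[set f : {ffun 'I_n -> 'I_r} | [forall j, f (g j) == j]]| = (r ^ (n - r))%N.
Proof.
move=> ginj; pose F i := [pred c : 'I_r | [forall j, (g j == i) ==> (c == j)]].
have FE i : #|F i| = (if i \in ~: (g @: setT) then r else 1)%N.
  rewrite inE; case: ifPn => [gi|]; last first.
    rewrite negbK => /imsetP[j _ ->].
    rewrite -(card1 j); apply: eq_card => c; rewrite !inE.
    apply/forallP/eqP => [/(_ j)|-> j']; first by rewrite eqxx => /eqP.
    by apply/implyP => /eqP/ginj ->.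
  rewrite -[RHS](card_ord r); apply: eq_card => c; rewrite !inE.
  by apply/forallP => j; apply/implyP => /eqP E; rewrite -E imset_f in gi.
transitivity #|family F|.
  apply: eq_card => f; rewrite inE; apply/forallP/familyP => H.
    by move=> i; rewrite inE; apply/forallP => j; apply/implyP => /eqP <-.
  by move=> j; have := H (g j); rewrite inE => /forallP/(_ j); rewrite eqxx.
rewrite card_family foldrE big_map big_enum /= (eq_bigr _ (fun i _ => FE i)).
rewrite -big_mkcond /= prod_nat_const; congr (_ ^ _)%N.
by rewrite cardsCs setCK card_imset// cardsT !card_ord.
Qed.

(** Double count pairs (f, g) with g a section of f onto [I]: there are r! bijections g, and each
    rainbow f has exactly one section. *)
Lemma card_rainbow (r n : nat) (I : {set 'I_n}) : #|I| = r ->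
  #|[set f : {ffun 'I_n -> 'I_r} | rainbow f I]| = (r`! * r ^ (n - r))%N.
Proof.
move=> cI.
have inj_im (g : {ffun 'I_r -> 'I_n}) : g @: setT = I -> injective g.
  move=> gI; have /imset_injP H : #|g @: setT| == #|[set: 'I_r]|.
    by rewrite gI cI cardsT card_ord.
  by move=> j j'; apply: H.
have <- : #|[set g : {ffun 'I_r -> 'I_n} | g @: setT == I]| = r`!.
  have -> : r`! = #|I| ^_ #|'I_r| by rewrite cI card_ord ffactnn.
  rewrite -card_inj_ffuns_on.
  apply: eq_card => g; rewrite !inE; apply/eqP/andP => [gI|[/ffun_onP gI /injectiveP ginj]].
    split; last by apply/injectiveP/inj_im.
    by apply/ffun_onP => j; rewrite -gI imset_f.
  apply/eqP; rewrite eqEcard cI card_imset// cardsT card_ord leqnn andbT.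
  by apply/subsetP => _ /imsetP[j _ ->].
rewrite -sum1_card (eq_bigl (fun f => rainbow f I)); last by move=> f; rewrite inE.
rewrite big_mkcond /= (eq_bigr (fun f => \sum_(g | section_on f I g) 1)%N).
  rewrite (exchange_big_dep (fun g : {ffun 'I_r -> 'I_n} => g @: setT == I)) /=.
    rewrite -sum_nat_const; under [RHS]eq_bigl do rewrite inE.
    apply: eq_bigr => g /eqP gI; rewrite -(card_extensions (inj_im _ gI)) -sum1_card.
    by apply: eq_bigl => f; rewrite inE /section_on gI eqxx andbT.
  by move=> f g _ /andP[].
move=> f _; transitivity (nat_of_bool (rainbow f I)); first by case: rainbow.
by rewrite -card_section_on -sum1_card; apply: eq_bigl => g; rewrite inE.
Qed.

Lemma ffact_le_exp (n m : nat) : (n ^_ m <= n ^ m)%N.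
Proof.
rewrite -[n in (n ^_ _)%N]card_ord -[m in (_ ^_ m)%N]card_ord -card_inj_ffuns.
by apply: leq_trans (max_card _) _; rewrite card_ffun !card_ord.
Qed.

(** * Linear forms of a colouring and choice of the constants *)

Definition color_form (R : realType) (r n : nat) (w : R) (f : {ffun 'I_n -> 'I_r})
    (j : 'I_r) (x : 'rV[R]_n) : R := w * \sum_(i | f i == j) x ord0 i.

Fact color_form_is_scalar (R : realType) (r n : nat) (w : R)
    (f : {ffun 'I_n -> 'I_r}) (j : 'I_r) : scalar (color_form w f j).
Proof.
move=> a x y; rewrite /color_form mulrCA -mulrDr [a * _]mulr_sumr -big_split.
by congr (_ * _); apply: eq_bigr => i _; rewrite !mxE.
Qed.

HB.instance Definition _ (R : realType) (r n : nat) (w : R)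
    (f : {ffun 'I_n -> 'I_r}) (j : 'I_r) :=
  GRing.isLinear.Build R 'rV[R]_n R *%R (color_form w f j)
    (color_form_is_scalar w f j).

(** The weight is put on the single colour [r0], so each product is scaled by [w] exactly once. *)
Lemma sum_of_products_color_form (R : realType) (r n k : nat) (r0 : 'I_r) (w : R)
    (s : 'I_k -> {ffun 'I_n -> 'I_r}) (x : 'rV[R]_n) :
  sum_of_products (fun i j => color_form (if j == r0 then w else 1) (s i) j) x =
  squarefree_poly r (fun I => w * (\sum_(i < k) rainbow (s i) I)%:R) x.
Proof.
rewrite /squarefree_poly /sum_of_products.
have prod_w : \prod_(j < r) (if j == r0 then w else 1) = w :> R.
  by rewrite -big_mkcond big_pred1_eq.
under eq_bigr do rewrite /color_form big_split /= prod_w prod_color_sums mulr_sumr.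
rewrite exchange_big /=; apply: eq_bigr => I _.
rewrite natr_sum mulr_sumr mulr_suml.
by apply: eq_bigr => i _; rewrite mulrA.
Qed.

(** [p] is the proportion r! r^(n-r) / r^n of colourings for which a given r-set is rainbow. The
    factor r + 1 comes from 2 C(n, r) <= n n^r. *)
Lemma exists_balanced_colorings (R : realType) (r n k : nat) (d : R) :
  (0 < r)%N -> (2 <= n)%N -> 0 < d < 1 ->
  let p : R := r`!%:R / (r ^ r)%:R in
  r.+1%:R * ln (n%:R : R) <= d ^+ 2 * (k%:R * p) ->
  exists s : 'I_k -> {ffun 'I_n -> 'I_r}, forall I : {set 'I_n}, #|I| = r ->
    (1 - d) ^+ 2 * (k%:R * p) <= (\sum_(i < k) rainbow (s i) I)%:R
      <= (1 + d) ^+ 2 * (k%:R * p).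
Proof.
move=> r0 n2 d01 p Hk.
have rr : (0 < r ^ r)%N by rewrite expn_gt0 r0.
have [||//|I /eqP cI||s Hs] := @exists_concentrated_sample R {ffun 'I_n -> 'I_r}
  {set 'I_n} (fun I => #|I| == r) (@rainbow r n) p d k.
- by rewrite card_ffun !card_ord expn_gt0 r0.
- rewrite divr_gt0 ?ltr0n ?fact_gt0//= /p ler_pdivrMr ?ltr0n// mul1r ler_nat.
  by rewrite -ffactnn ffact_le_exp.
- have rn : (r <= n)%N by rewrite -cI -[leqRHS]card_ord max_card.
  rewrite card_rainbow// card_ffun !card_ord -[n in X in _ = _ * X](subnK rn).
  by rewrite expnD !natrM /p; field; rewrite pnatr_eq0 -lt0n rr.
- apply: le_trans Hk; set N := #|_|.
  (* If r > n there are no r-sets, and [ln 0] is 0 by convention. *)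
  have [->|N0] := posnP N.
    by rewrite muln0 ln0// mulr_ge0// ln_ge0// ler1n; lia.
  rewrite mulr_natl -lnXn ?ltr0n//; last by lia.
  rewrite -natrX ler_ln ?posrE ?ltr0n ?muln_gt0 ?expn_gt0//; last by lia.
  rewrite ler_nat expnS leq_mul// (leq_trans _ (ffact_le_exp n r))//.
  rewrite -bin_ffact (_ : N = 'C(n, r)) ?leq_pmulr ?fact_gt0//.
  by rewrite -[n in RHS]card_ord -card_draws /N cardsE.
by exists s => I cI; apply: Hs; rewrite cI.
Qed.

(** Since d <= 1, both squares are within 3d of 1, and [d] is chosen so that 3d times the midpoint
    is half the length of the interval. *)
Lemma weighted_in_interval (R : realFieldType) (lo hi d m q : R) :
  0 <= lo -> lo < hi -> d = (hi - lo) / (hi + lo) / 3%:R -> 0 < q ->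
  (1 - d) ^+ 2 * q <= m <= (1 + d) ^+ 2 * q ->
  lo <= (lo + hi) / 2%:R / q * m <= hi.
Proof.
move=> lo0 lohi dE q0; have s0 : 0 < hi + lo by lra.
rewrite -mulrA [q^-1 * m]mulrC -(ler_pdivlMr _ _ q0) -(ler_pdivrMr _ _ q0).
set u := m / q => /andP[m1 m2].
have dlh : 3%:R * d * (hi + lo) = hi - lo by rewrite dE; field; rewrite gt_eqF.
have d0 : 0 <= d by rewrite dE !divr_ge0//; lra.
have d1 : d <= 1 by rewrite -(ler_pM2r s0); lra.
have dd : d ^+ 2 <= d by rewrite expr2 ler_piMl.
have u1 : u <= 1 + 3%:R * d by lra.
have u2 : 1 - 3%:R * d <= u by have := sqr_ge0 d; lra.
have := ler_wpM2l (ltW s0) u1; have := ler_wpM2l (ltW s0) u2; lra.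
Qed.

Theorem theorem1p4 (R : realType) (r : nat) (eps : R)
    (r_gt0 : (0 < r)%N) (eps_gt0 : 0 < eps) :
  exists kappa : R, 0 < kappa /\
    forall n : nat, (2 <= n)%N ->
    exists (k : nat) (l : 'I_k -> 'I_r -> {scalar 'rV[R]_n})
           (c : {set 'I_n} -> R),
      [/\ k%:R <= kappa * ln (n%:R : R),
          forall x : 'rV[R]_n, sum_of_products l x = squarefree_poly r c x
        & forall I : {set 'I_n}, #|I| = r ->
            (1 - eps) ^+ r <= c I <= (1 + eps) ^+ r].
Proof.
(* For eps > 1 and r even the lower bound is positive and may exceed 1, so the
   coefficients are centered at the midpoint of the interval, not at 1. *)
pose lo := Num.max ((1 - eps) ^+ r) 0; pose hi := (1 + eps) ^+ r.
(* Truncation at 0 matters for eps > 1 and r odd: it keeps (hi - lo) / (hi + lo) at most 1, hence d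
   < 1. *)
have lo0 : 0 <= lo by rewrite le_max lexx orbT.
have lohi : lo < hi.
  rewrite gt_max exprn_gt0 ?andbT; last lra.
  apply: (@le_lt_trans _ _ (`|1 - eps| ^+ r)); first by rewrite -normrX ler_norm.
  by rewrite ltrXn2r ?gtn_eqF// ltr_norml; lra.
pose d := (hi - lo) / (hi + lo) / 3%:R.
have d0 : 0 < d by rewrite !divr_gt0//; lra.
have d1 : d < 1 by rewrite /d ltr_pdivrMr// ltr_pdivrMr; lra.
pose p : R := r`!%:R / (r ^ r)%:R.
have p0 : 0 < p by rewrite divr_gt0 ?ltr0n ?fact_gt0 ?expn_gt0 ?r_gt0.
(* The sample size condition of [exists_balanced_colorings] reads k >= K ln n. *)
pose K := r.+1%:R / (d ^+ 2 * p).
have dp0 : 0 < d ^+ 2 * p by rewrite mulr_gt0 ?exprn_gt0.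
have K0 : 0 < K by rewrite divr_gt0.
have ln2 : 0 < ln (2%:R : R) by rewrite ln_gt0// ltr1n.
(* The term 1 / ln 2 pays for rounding k up: it contributes ln n / ln 2 >= 1. *)
exists (K + (ln 2%:R)^-1); split; first by rewrite addr_gt0 ?invr_gt0.
move=> n n2; have lnn : ln (2%:R : R) <= ln n%:R.
  by rewrite ler_ln ?posrE ?ltr0n ?ler_nat//; lia.
have Kn0 : 0 <= K * ln n%:R by rewrite mulr_ge0; lra.
pose k := (Num.truncn (K * ln (n%:R : R))).+1.
have [||s Hs] := @exists_balanced_colorings R r n k d r_gt0 n2.
- by rewrite d0.
- rewrite mulrCA -ler_pdivrMr// mulrAC; exact/ltW/truncnS_gt.
(* Scales the expected count k p to the midpoint of the interval. *)
pose w := (lo + hi) / 2%:R / (k%:R * p).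
exists k, (fun i j => color_form (if j == Ordinal r_gt0 then w else 1) (s i) j).
exists (fun I => w * (\sum_(i < k) rainbow (s i) I)%:R); split.
- by rewrite mulrDl /k -natr1 lerD ?truncn_le// mulrC ler_pdivlMr ?mul1r.
- exact: sum_of_products_color_form.
- move=> I cI; have q0 : 0 < k%:R * p by rewrite mulr_gt0.
  have /andP[+ ->] := weighted_in_interval lo0 lohi erefl q0 (Hs I cI).
  by rewrite andbT; apply: le_trans; rewrite le_max lexx.
Qed.
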